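(* Let $m\ge n \ge 3$ be integers. Then $$a_1(C_n \,\square\, C_m) = \begin{cases} 1; & n = m = 3,\\ 2; & n = 3,\ m = 4,\\ 3; & n = 3,\ m \ge 5,\\ 4; & m\ge n\ge 4, \end{cases}$$ and $$a_1'(C_n \,\square\, C_m) = \begin{cases} 1; & n = m = 3,\\ 3; & n = 3,\ m\ge 4,\\ 4; & m\ge n\ge 4. \end{cases}$$
   Context: $C_n$ is the cycle on $n$ vertices. The Cartesian product $G\,\square\, H$ of graphs $G$ and $H$ has vertex set $V(G)\times V(H)$, with $(g,h)$ and $(g',h')$ adjacent if either $gg'\in E(G)$ and $h=h'$, or $g=g'$ and $hh'\in E(H)$. A clique of a graph $G$ is an inclusion-wise maximal complete subgraph. The $(a,b)$-monochromatic clique transversal game ($(a,b)$-MCT game) on $G$ is played by Alice and Bob, who alternately take turns: in each of her turns Alice chooses $a$ unplayed vertices and colors them red, and in each of his turns Bob chooses $b$ unplayed vertices and colors them blue (if fewer unplayed vertices remain, the player colors all of them). Alice wins if the red vertices contain at least one vertex of each clique of $G$; Bob wins if all vertices of some clique of $G$ are blue. The game is Alice-start or Bob-start depending on who moves first. The threshold $a_1(G)$ (resp. $a_1'(G)$) is the smallest positive integer $a$ such that Alice has a winning strategy in the Alice-start (resp. Bob-start) $(a,1)$-MCT game on $G$. *)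

(* Defs.v *)
From mathcomp Require Import all_boot.

Set Implicit Arguments.
Unset Strict Implicit.
Unset Printing Implicit Defensive.

(* Simple graphs are given by their adjacency relation, a symmetric and
   irreflexive [rel T] on a finite type of vertices. *)

(* This is the simple graph C_n only for n >= 3; for n = 1 it has a loop. *)
Definition cycle_graph (n : nat) : rel 'I_n :=
  fun i j => (j == i.+1 %% n :> nat) || (i == j.+1 %% n :> nat).

Definition cartesian_product (T U : finType) (g : rel T) (h : rel U) :
    rel (T * U)%type :=
  fun x y => (g x.1 y.1 && (x.2 == y.2)) || ((x.1 == y.1) && h x.2 y.2).

Lemma cycle_graph_sym n : symmetric (@cycle_graph n).
Proof. by move=> i j; rewrite /cycle_graph orbC. Qed.

Lemma cycle_graph_irr n : 1 < n -> irreflexive (@cycle_graph n).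
Proof.
move=> n1 i; rewrite /cycle_graph orbb; apply/negbTE/eqP => /eqP.
have [lt|] := ltnP i.+1 n; first by rewrite modn_small // ltn_eqF.
move=> le; have -> : i.+1 = n by apply/eqP; rewrite eqn_leq le ltn_ord.
by rewrite modnn => /eqP i0; move: le; rewrite i0 leqNgt n1.
Qed.

Lemma cartesian_product_sym (T U : finType) (g : rel T) (h : rel U) :
  symmetric g -> symmetric h -> symmetric (cartesian_product g h).
Proof.
move=> gs hs x y; rewrite /cartesian_product gs hs.
by rewrite (eq_sym x.1) (eq_sym x.2).
Qed.

Lemma cartesian_product_irr (T U : finType) (g : rel T) (h : rel U) :
  irreflexive g -> irreflexive h -> irreflexive (cartesian_product g h).
Proof. by move=> gi hi x; rewrite /cartesian_product gi hi andbF. Qed.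

Definition complete (T : finType) (e : rel T) (K : {set T}) : bool :=
  [forall x in K, forall y in K, (x != y) ==> e x y].

Definition clique (T : finType) (e : rel T) (K : {set T}) : bool :=
  maxset (complete e) K.

Record position (T : finType) := Position { red : {set T}; blue : {set T} }.

Section Game.

Variables (T : finType) (e : rel T).
Implicit Types (p : position T) (S : {set T}).

Definition unplayed p : {set T} := ~: (red p :|: blue p).

Definition legal (k : nat) p S : bool :=
  (S \subset unplayed p) && (#|S| == minn k #|unplayed p|).

Definition alice_move p S : position T := Position (red p :|: S) (blue p).
Definition bob_move p S : position T := Position (red p) (blue p :|: S).

Definition alice_wins p : bool :=
  [forall K : {set T}, clique e K ==> (K :&: red p != set0)].
Definition bob_wins p : bool :=
  [exists K : {set T}, clique e K && (K \subset blue p)].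

(* A strategy gives the set to color from the current position and the list
   of all earlier positions, most recent first. *)
Definition strategy := position T -> seq (position T) -> {set T}.

(* [play b alice_first s t p h]: some play in which Alice follows [s] and Bob
   colors [b] vertices per turn has reached position [p] after the positions
   [h]; the boolean [t] tells whether Alice is next to move. *)
Inductive play (b : nat) (alice_first : bool) (s : strategy) :
    bool -> position T -> seq (position T) -> Prop :=
| PlayStart : play b alice_first s alice_first (Position set0 set0) [::]
| PlayAlice p h : play b alice_first s true p h ->
    play b alice_first s false (alice_move p (s p h)) (p :: h)
| PlayBob p h S : play b alice_first s false p h -> legal b p S ->
    play b alice_first s true (bob_move p S) (p :: h).

(* Plays go on until every vertex is colored. This decides the same winner as
   stopping at the first winning position: both winning conditions persist
   under further moves, and by [alice_winsE] exactly one holds at the end. *)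
Definition winning_strategy (a b : nat) (alice_first : bool) (s : strategy) :=
  (forall p h, play b alice_first s true p h -> legal a p (s p h)) /\
  (forall t p h, play b alice_first s t p h -> unplayed p = set0 ->
     alice_wins p).

Definition alice_has_winning_strategy (a b : nat) (alice_first : bool) : Prop :=
  exists s : strategy, winning_strategy a b alice_first s.

Lemma alice_winsE p : [disjoint red p & blue p] -> unplayed p = set0 ->
  alice_wins p = ~~ bob_wins p.
Proof.
move=> dis full; rewrite /bob_wins negb_exists; apply: eq_forallb => K.
rewrite negb_and -implybE; congr (_ ==> _).
have compl : ~: red p = blue p.
  apply/setP => x; move/setP/(_ x): full; rewrite !inE => /negbFE.
  by case: (boolP (x \in red p)) => [xr _|_ /= -> //]; rewrite (disjointFr dis).
by rewrite -compl -disjoints_subset -setI_eq0.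
Qed.

(* The least such [a] need not exist: with an isolated vertex, Bob wins the
   Bob-start game for every [a]. Hence thresholds are relations. *)
Definition is_threshold (alice_first : bool) (a : nat) : Prop :=
  [/\ 0 < a, alice_has_winning_strategy a 1 alice_first &
      forall a', 0 < a' -> alice_has_winning_strategy a' 1 alice_first ->
        a <= a'].

Definition is_a1 : nat -> Prop := is_threshold true.
Definition is_a1' : nat -> Prop := is_threshold false.

End Game.

(* Main.v *)
(* If n, m >= 4, the cliques are the edges of a 4-regular graph: Alice wins with
   4 by coloring the neighborhood of Bob's vertex, and loses with 3 because her
   first 3 vertices dominate at most 15 of the nm >= 16 vertices, so that Bob
   can play a vertex with four free neighbors.
   If n = 3, every clique through (i, j) other than its triangle is an edge to
   (i, j - 1) or (i, j + 1) (when m >= 4), so Alice wins with 3. With 2 she loses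
   as soon as Bob finds a layer j free of red vertices in which two columns are
   free of red in the adjacent layers: playing the first column forces her two
   replies, and playing the second one then makes three threats. Two red
   vertices destroy all such layers only if m = 4. The remaining wins of Alice,
   on C_3 x C_3 and on C_3 x C_4, are found by searching the game tree. *)
Require Import Defs.
From mathcomp Require Import all_boot.

Set Implicit Arguments.
Unset Strict Implicit.
Unset Printing Implicit Defensive.

(** * Winning strategies and cliques in general graphs *)

Lemma subset_card_between (T : finType) (A B : {set T}) k :
  A \subset B -> #|A| <= k <= #|B| ->
  exists C : {set T}, [/\ A \subset C, C \subset B & #|C| = k].
Proof.
move=> AB /andP[Ak kB].
have sz : k - #|A| <= size (enum (B :\: A)).
  by rewrite -cardE cardsD (setIidPr AB) leq_sub2r.
pose E := take (k - #|A|) (enum (B :\: A)).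
have EP x : x \in E -> x \in B :\: A by move/mem_take; rewrite mem_enum.
exists (A :|: [set x in E]); split; first exact: subsetUl.
  rewrite subUset AB; apply/subsetP => x; rewrite inE => /EP.
  by rewrite inE => /andP[].
rewrite cardsU (_ : A :&: _ = set0) ?cards0 ?subn0; last first.
  by apply/setP => x; rewrite !inE; apply/andP=> -[xA /EP]; rewrite inE xA.
rewrite cardsE; have /card_uniqP -> : uniq E by rewrite take_uniq ?enum_uniq.
by rewrite size_takel // subnKC.
Qed.

Section Strategies.
Variables (T : finType) (e : rel T).
Implicit Types (p : position T) (S K : {set T}).

(** Legal moves have an exact size; this pads the vertices that matter to Alice with arbitrary
    unplayed ones. *)
Lemma legal_extend k p S : S \subset unplayed p -> #|S| <= k ->
  exists2 S' : {set T}, S \subset S' & legal k p S'.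
Proof.
move=> Su Sk; have := subset_card_between (k := minn k #|unplayed p|) Su.
rewrite leq_min Sk subset_leq_card // geq_minr => /(_ isT)[C [SC Cu cC]].
by exists C; rewrite // /legal Cu cC eqxx.
Qed.

Lemma legal1 p x : x \in unplayed p -> legal 1 p [set x].
Proof.
move=> xu; rewrite /legal sub1set xu cards1 eq_sym.
by apply/eqP/minn_idPl/card_gt0P; exists x.
Qed.

Lemma legal1P p S : legal 1 p S ->
  (S = set0 /\ unplayed p = set0) \/ exists2 x, x \in unplayed p & S = [set x].
Proof.
case/andP=> Su /eqP cS; have [u0|/set0Pn[y yu]] := eqVneq (unplayed p) set0.
  by left; split=> //; move: Su; rewrite u0 subset0 => /eqP.
right; have /cards1P[x Sx] : #|S| == 1.
  by rewrite cS; apply/eqP/minn_idPl; apply/card_gt0P; exists y.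
by exists x; rewrite // (subsetP Su) // Sx set11.
Qed.

Lemma disjoint_unplayed p S (A : {set T}) : S \subset unplayed p ->
  A \subset red p :|: blue p -> [disjoint S & A].
Proof.
rewrite disjoints_subset => Su Ap; apply: subset_trans Su _.
by rewrite setCS.
Qed.

Lemma alice_move_disjoint p S : [disjoint red p & blue p] ->
  S \subset unplayed p -> [disjoint red (alice_move p S) & blue (alice_move p S)].
Proof.
move=> dis Su /=; rewrite -setI_eq0 setIUl setU_eq0 !setI_eq0 dis.
exact: disjoint_unplayed Su (subsetUr _ _).
Qed.

Lemma bob_move_disjoint p S : [disjoint red p & blue p] ->
  S \subset unplayed p -> [disjoint red (bob_move p S) & blue (bob_move p S)].
Proof.
move=> dis Su /=; rewrite -setI_eq0 setIUr setU_eq0 !setI_eq0 dis.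
by rewrite disjoint_sym; apply: disjoint_unplayed Su (subsetUl _ _).
Qed.

(* [Inv] is evaluated when Bob is to move. Alice's reply to [x] only has to
   contain [S0], so that surplus choices never need to be discussed. *)
Lemma invariant_strategy a (alice_first : bool) (Inv : pred (position T)) :
  (forall p, [disjoint red p & blue p] -> Inv p -> ~~ bob_wins e p) ->
  (if alice_first then exists2 S0 : {set T}, #|S0| <= a &
     forall S, S0 \subset S -> Inv (Position S set0)
   else Inv (Position set0 set0)) ->
  (forall p x, [disjoint red p & blue p] -> Inv p -> x \in unplayed p ->
     exists S0 : {set T},
      [/\ S0 \subset unplayed (bob_move p [set x]), #|S0| <= a &
       forall S, S0 \subset S -> Inv (alice_move (bob_move p [set x]) S)]) ->
  alice_has_winning_strategy e a 1 alice_first.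
Proof.
move=> Iwin Istart Istep.
pose good p S := legal a p S && Inv (alice_move p S).
(* The history is ignored, and the default [set0] is never reached: [inv] shows that a good move
   exists whenever Alice is to move. *)
pose s : strategy T := fun p _ => odflt set0 [pick S | good p S].
have sP p h : (exists S, good p S) -> good p (s p h).
  by case=> S gS; rewrite /s; case: pickP => //= /(_ S); rewrite gS.
have inv t p h : play 1 alice_first s t p h -> [disjoint red p & blue p] /\
    if t then exists S, good p S else Inv p.
  elim=> {t p h} [|p h _ [dis /sP-/(_ h)/andP[/andP[su _] Ip]]|p h S _ [dis Ip]].
  - split; first by rewrite /= disjoints_subset sub0set.
    case: alice_first Istart => //; case=> S0 S0a IS.
    have [|S1 S01 lS1] := @legal_extend a (Position set0 set0) S0 _ S0a.
      by rewrite /unplayed /= setU0 setC0 subsetT.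
    by exists S1; rewrite /good lS1 /alice_move /= set0U IS.
  - by split; first exact: alice_move_disjoint.
  move=> lS; split; first by case/andP: lS => Su _; apply: bob_move_disjoint.
  case: (legal1P lS) => [[-> u0]|[x xu ->]].
    (* On a full board both players pass, so [Inv p] simply persists. *)
    have -> : bob_move p set0 = p by rewrite /bob_move setU0; case: (p).
    exists set0; rewrite /good /legal u0 sub0set !cards0 minn0 /=.
    by rewrite /alice_move setU0; case: (p) Ip.
  have [S0 [S0u S0a IS]] := Istep p x dis Ip xu.
  have [S1 S01 lS1] := legal_extend S0u S0a.
  by exists S1; rewrite /good lS1 IS.
exists s; split=> [p h /inv[_ /sP-/(_ h)/andP[]]//|t p h /inv[dis It] full].
rewrite alice_winsE //; apply: Iwin => //.
(* If Alice is to move on the full board, her good move is empty, so [Inv] holds already. *)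
case: t It => // -[S /andP[/andP[]]]; rewrite full subset0 => /eqP-> _.
by rewrite /alice_move setU0; case: (p).
Qed.

Lemma clique_complete K x y : clique e K -> x \in K -> y \in K -> x != y ->
  e x y.
Proof.
by case/maxsetP=> /forall_inP cK _ /cK /forall_inP cx /cx /implyP.
Qed.

Lemma cliqueP K : clique e K ->
  forall B : {set T}, (forall x y, x \in B -> y \in B -> x != y -> e x y) ->
  K \subset B -> B = K.
Proof.
case/maxsetP=> _ mK B cB KB; apply: mK KB; apply/forall_inP => x xB.
by apply/forall_inP => y yB; apply/implyP; apply: cB.
Qed.

(** The vertex [x] excludes the empty graph, in which [set0] is a clique. *)
Lemma clique_nonempty (x : T) K : clique e K -> K != set0.
Proof.
move=> cK; apply/eqP => K0; have := cliqueP cK (B := [set x]).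
rewrite K0 sub0set => /(_ _ isT) /setP/(_ x); rewrite !inE eqxx => H.
suff: true = false by [].
by apply: H => y z /set1P-> /set1P->; rewrite eqxx.
Qed.

(* Alice answers [x] by coloring [D x], hence every clique that meets the blue
   vertices also meets the red ones. *)
Lemma cover_strategy (x0 : T) a alice_first (D : T -> {set T}) :
  (forall x, x \notin D x) -> (forall x, #|D x| <= a) ->
  (forall x K, clique e K -> x \in K -> exists2 y, y \in D x & y \in K) ->
  alice_has_winning_strategy e a 1 alice_first.
Proof.
move=> xD Da DK.
pose Inv p := [forall K : {set T},
  clique e K ==> [disjoint K & red p] ==> [disjoint K & blue p]].
apply: (@invariant_strategy _ _ Inv) => [p dis /forallP Ip||p x dis /forallP Ip xu].
- apply/existsP => -[K /andP[cK Kb]]; have := Ip K.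
  have -> : [disjoint K & red p] by rewrite (disjointWl Kb) // disjoint_sym.
  rewrite cK => /(disjointWr Kb).
  by rewrite -setI_eq0 setIid; apply/negP/(clique_nonempty x0).
- have I0 S : Inv (Position S set0).
    by apply/forallP => K; do 2![apply/implyP => _]; rewrite -setI_eq0 setI0.
  by case: alice_first => //; exists set0; rewrite ?cards0.
exists (D x :&: unplayed (bob_move p [set x])).
split; [exact: subsetIr | exact: leq_trans (subset_leq_card (subsetIl _ _)) _|].
move=> S DS; apply/forallP => K; apply/implyP => cK; apply/implyP.
rewrite -setI_eq0 /= setIUr setU_eq0 !setI_eq0 => /andP[Kr KS].
have Kb : [disjoint K & blue p] by move: (Ip K); rewrite cK Kr.
rewrite -setI_eq0 setIUr setU_eq0 !setI_eq0 Kb /=.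
rewrite disjoint_sym disjoints1; apply/negP => xK.
(* [y] cannot have been played: [K] has no red vertex, hence by the invariant no earlier blue one,
   and [y] is not [x]. So Alice's reply contains [y]. *)
have [y yD yK] := DK x K cK xK.
have /negP[] : y \notin S by rewrite (disjointFr KS).
apply: (subsetP DS); rewrite !inE yD !negb_or (disjointFr Kr) //.
by rewrite (disjointFr Kb) //=; apply: contraTneq yD => ->.
Qed.

(** [R] holds at the positions reachable against a winning strategy, with the histories forgotten.
    No blue clique occurs in them, because it would persist until the board is full. *)
Lemma winning_positions a alice_first :
  alice_has_winning_strategy e a 1 alice_first ->
  exists R : bool -> position T -> Prop,
   [/\ R alice_first (Position set0 set0),
       forall p, R true p -> exists2 S, legal a p S & R false (alice_move p S),
       forall p x, R false p -> x \in unplayed p -> R true (bob_move p [set x]) &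
       forall t p, R t p -> ~~ bob_wins e p].
Proof.
case=> s [leg win]; pose R t p := exists h, play 1 alice_first s t p h.
have RA p : R true p -> exists2 S, legal a p S & R false (alice_move p S).
  by case=> h pl; exists (s p h); [exact: leg|exists (p :: h); constructor].
have RB p S : R false p -> legal 1 p S -> R true (bob_move p S).
  by case=> h pl lS; exists (p :: h); constructor.
have Rdis t p : R t p -> [disjoint red p & blue p].
  case=> h; elim=> {t p h} [|p h pl dis|p h S _ dis /andP[Su _]].
  - by rewrite /= disjoints_subset sub0set.
  - by apply: alice_move_disjoint => //; case/andP: (leg _ _ pl).
  - exact: bob_move_disjoint.
exists R; split=> //; first by exists [::]; constructor.
  by move=> p x Rp xu; apply: RB => //; apply: legal1.
(* Alice may color nothing (if [a] is 0), and then only the turn [t] makes the measure drop; a move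
   of Bob removes 2 and adds 1. *)
move=> t p; have [k] := ubnP (#|unplayed p|.*2 + t).
elim: k t p => // k IH t p lek Rp.
have [u0|/set0Pn[x xu]] := eqVneq (unplayed p) set0.
  by rewrite -alice_winsE ?(Rdis t) //; case: Rp => h /win; apply.
case: t lek Rp => [lek /RA[S lS]|lek /RB RS].
  apply: IH; rewrite -ltnS; apply: leq_trans lek; rewrite addn0 addn1 !ltnS.
  by rewrite leq_double subset_leq_card // setCS setSU // subsetUl.
suff: ~~ bob_wins e (bob_move p [set x]).
  apply: contraNN => /existsP[K /andP[cK Kb]]; apply/existsP; exists K.
  by rewrite cK (subset_trans Kb) // subsetUl.
apply: IH; last by apply: RS; apply: legal1.
have -> : unplayed (bob_move p [set x]) = unplayed p :\ x.
  by apply/setP => y; rewrite !inE !negb_or andbA andbC.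
move: lek; rewrite (cardsD1 x (unplayed p)) xu /= add1n doubleS addn0 addn1.
by rewrite ltnS.
Qed.

(** [W] is a set of threats: if Alice left one of its vertices unplayed, Bob would complete a blue
    clique there. *)
Lemma forced_reply R a p (W : {set T}) :
  (forall p, R true p -> exists2 S, legal a p S & R false (alice_move p S)) ->
  (forall p x, R false p -> x \in unplayed p -> R true (bob_move p [set x])) ->
  (forall t p, R t p -> ~~ bob_wins e p) ->
  R true p ->
  (forall y, y \in W -> y \in unplayed p /\
     exists2 K, clique e K & K \subset y |: blue p) ->
  exists S, [/\ W \subset S, #|S| <= a & R false (alice_move p S)].
Proof.
move=> RA RB Rw /RA[S lS RS] WP; exists S.
case/andP: (lS) => Su /eqP cS; split=> //; last by rewrite cS geq_minl.
apply/subsetP => y /WP[yu [K cK Ky]]; apply: contraT => yS.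
have yu' : y \in unplayed (alice_move p S).
  by move: yu; rewrite !inE !negb_or yS andbT.
have /existsP[] := Rw _ _ (RB _ _ RS yu').
by exists K; rewrite cK /= setUC.
Qed.

Lemma clique_edge x y : symmetric e -> e x y ->
  (forall z, e x z -> e y z -> False) -> clique e [set x; y].
Proof.
move=> es exy tri; apply/maxsetP; split.
  apply/forall_inP => u /set2P[]->; apply/forall_inP => v /set2P[]->;
    by rewrite ?eqxx ?exy ?implybT // es exy implybT.
move=> B /forall_inP cB; rewrite subUset !sub1set => /andP[xB yB].
apply/eqP; rewrite eqEsubset subUset !sub1set xB yB !andbT.
apply/subsetP => z zB; rewrite !inE; apply: contraT; rewrite negb_or => /andP[zx zy].
have c u v : u \in B -> v \in B -> u != v -> e u v.
  by move=> /cB /forall_inP cu /cu /implyP.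
by case: (tri z); apply: c => //; rewrite eq_sym.
Qed.
End Strategies.

(** * A game tree search on lists of lines *)

Section LineGame.
Variables (U : eqType) (V : seq U) (a : nat).
Implicit Types (l S : seq U) (L : seq (seq U)).

Fixpoint choices (k : nat) (s : seq U) : seq (seq U) :=
  if k is k'.+1 then
    if s is x :: s' then [seq x :: c | c <- choices k' s'] ++ choices k s'
    else [::]
  else [:: [::]].

(** On the lines, [hit] is the effect of Alice's move and [del] that of Bob's. *)
Definition hit S L : seq (seq U) := [seq l <- L | ~~ has (mem S) l].
Definition del (x : U) L : seq (seq U) := [seq filter (predC1 x) l | l <- L].

(* [L] holds the lines without red vertices, stripped of their blue vertices,
   and Bob is to move: he wins at once if some line has at most one vertex left.
   Positions are forgotten, so Alice's replies range over all of [V]; replies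
   to vertices outside the lines are irrelevant by [safe_sub]. *)
Fixpoint safe (k : nat) L : bool :=
  if has (fun l => size l <= 1) L then false
  else if nilp L then true
  else if k is k'.+1 then
    all (fun x => has (fun S => safe k' (hit S (del x L))) (choices a V))
        (undup (flatten L))
  else false.

Lemma choicesP k s S : S \in choices k s -> {subset S <= s} /\ size S = k.
Proof.
elim: s k S => [|x s IH] [|k] S //=; rewrite ?inE; try by move=> /eqP->.
rewrite mem_cat => /orP[/mapP[S' /IH[S's <-] ->]|/IH[Ss ->]]; split=> // y.
  by rewrite !inE => /predU1P[->|/S's ->]; rewrite ?eqxx ?orbT.
by rewrite inE => /Ss ->; rewrite orbT.
Qed.

Lemma sub_flatten L1 L2 : {subset L1 <= L2} ->
  {subset flatten L1 <= flatten L2}.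
Proof.
by move=> L12 x /flattenP[l /L12 lL xl]; apply/flattenP; exists l.
Qed.

Lemma hit_sub S L1 L2 : {subset L1 <= L2} -> {subset hit S L1 <= hit S L2}.
Proof. by move=> L12 l; rewrite !mem_filter => /andP[-> /L12]. Qed.

Lemma del_sub x L1 L2 : {subset L1 <= L2} -> {subset del x L1 <= del x L2}.
Proof. by move=> L12 ? /mapP[l /L12 lL ->]; apply: map_f. Qed.

(** Alice's replies for [L2] still work when there are fewer lines. Order and multiplicity of the
    lines do not matter either. *)
Lemma safe_sub k L1 L2 : {subset L1 <= L2} -> safe k L2 -> safe k L1.
Proof.
elim: k L1 L2 => [|k IH] L1 L2 L12 /=.
  case: ifPn => // noW; case: ifPn => // /nilP L20 _; move: L12; rewrite L20.
  by case: L1 => // l L1 /(_ l (mem_head _ _)).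
case: ifPn => // /hasPn noW L2s; case: ifPn => [/hasP[l /L12/noW/negbTE-> //]|_].
case: ifPn => // L10; move: L2s; case: ifPn => [/nilP L20 _|_ /allP L2s].
  by case: L1 L12 L10 => // l L1; rewrite L20 => /(_ l (mem_head _ _)).
apply/allP => x; rewrite mem_undup => /(sub_flatten L12) xL.
have /hasP[S SV Ss] := L2s x (etrans (mem_undup _ _) xL).
by apply/hasP; exists S => //; apply: IH Ss; apply/hit_sub/del_sub.
Qed.

Lemma safe_reply k L x : safe k L -> x \in flatten L ->
  exists i S, [/\ i < k, S \in choices a V & safe i (hit S (del x L))].
Proof.
case: k => [|k] /=; case: ifP => // _; case: ifPn => //; try by move=> /nilP->.
move=> _ /allP Ls xL; have /hasP[S SV sS] := Ls x (etrans (mem_undup _ _) xL).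
by exists k, S.
Qed.

Variables (T : finType) (e : rel T) (f : T -> U) (L0 : seq (seq U)).
Hypothesis f_inj : injective f.
Hypothesis f_onto : forall v, v \in V -> exists x, f x = v.
Hypothesis L0_sub : forall l, l \in L0 -> {subset l <= V}.
(** Lines need not be cliques: a line inside each clique suffices, and extra lines only make Alice's
    task harder. *)
Hypothesis L0_clique : forall K : {set T}, clique e K ->
  exists2 l, l \in L0 & forall x, f x \in l -> x \in K.

Definition residual (p : position T) : seq (seq U) :=
  [seq [seq v <- l | v \notin image f (blue p)] |
     l <- hit (image f (red p)) L0].

(* [S0] is Alice's opening. *)
Lemma line_game_strategy (alice_first : bool) (k : nat) (S0 : seq U) :
  {subset S0 <= V} -> size S0 <= a -> alice_first || nilp S0 ->
  safe k (hit S0 L0) -> alice_has_winning_strategy e a 1 alice_first.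
Proof.
move=> S0V S0a S0start safe0.
(* The fuel decreases with each reply, so the invariant asks for some fuel up to [k]. *)
pose Inv (p : position T) := has (fun i => safe i (residual p)) (iota 0 k.+1).
have InvI i p : i <= k -> safe i (residual p) -> Inv p.
  by move=> ik si; apply/hasP; exists i; rewrite // mem_iota.
pose toT S : {set T} := [set x | f x \in S].
have toT_card S : #|toT S| <= size S.
  rewrite cardE -(size_map f); apply: uniq_leq_size.
    by rewrite map_inj_uniq // enum_uniq.
  by move=> _ /mapP[x + ->]; rewrite mem_enum inE.
apply: (@invariant_strategy _ _ _ _ Inv) => [p dis||p x dis].
- case/hasP=> i _ si; apply/existsP => -[K /andP[/L0_clique[l lL lK] Kb]].
  (* A line inside a blue clique would be reduced to the empty list, which [safe] rejects. *)
  suff : [::] \in residual p.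
    by move=> n; case: i si => [|i] /=; rewrite (introT hasP) //; exists [::].
  apply/mapP; exists l.
    rewrite mem_filter lL andbT; apply/hasPn => v vl; apply/imageP => -[x xr vx].
    move: vl; rewrite vx => /lK /(subsetP Kb); by rewrite (disjointFr dis).
  apply/esym/eqP; rewrite -[_ == _]negbK -has_filter; apply/hasPn => v vl.
  have [x fx] := f_onto (L0_sub lL vl); rewrite negbK; apply/imageP; exists x => //.
  by apply: (subsetP Kb); apply: lK; rewrite fx.
- have start (S : {set T}) : toT S0 \subset S -> Inv (Position S set0).
    move=> S0S; apply: (InvI k) => //; apply: safe_sub safe0 => ? /mapP[l].
    rewrite mem_filter => /andP[lr lL] ->.
    rewrite (_ : [seq _ <- l | _] = l); last first.
      by apply/all_filterP/allP => v _; apply/imageP => -[x]; rewrite inE.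
    rewrite mem_filter lL andbT; apply: contra lr => /hasP[v vl vS].
    apply/hasP; exists v => //=; have [x fx] := f_onto (S0V _ vS).
    by rewrite -fx; apply/image_f/(subsetP S0S); rewrite inE fx.
  case: alice_first S0start => /= [_|/nilP S00].
    by exists (toT S0); rewrite // (leq_trans (toT_card _)).
  by apply: start; apply/subsetP => x; rewrite inE S00.
case/hasP=> i; rewrite mem_iota ltnS /= => ik si xu.
set p' := bob_move p [set x].
(* Played vertices of [W] need no coloring: a red one has discarded its lines, and a blue one has
   been deleted from them. *)
have step W (S : {set T}) : {subset W <= V} -> toT W :&: unplayed p' \subset S ->
  {subset residual (alice_move p' S) <= hit W (del (f x) (residual p))}.
  move=> WV /subsetP WS l' /mapP[l]; rewrite mem_filter => /andP[lr lL] ->.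
  rewrite mem_filter; apply/andP; split.
    apply/hasPn => v; rewrite mem_filter => /andP[vb vl].
    apply: contra lr => vW; have vW1 : v \in W := vW.
    apply/hasP; exists v => //=.
    have [y fy] := f_onto (WV _ vW); move: vb; rewrite -fy mem_image // => yb.
    rewrite mem_image //=.
    move: yb (WS y); rewrite /= !inE fy vW1 => /negbTE->; rewrite orbF.
    by case: (y \in red p) => //= ->.
  apply/mapP; exists [seq v <- l | v \notin image f (blue p)].
    apply: map_f; rewrite mem_filter lL andbT; apply: contra lr.
    case/hasP=> v vl /imageP[y yr vy]; apply/hasP; exists v => //=.
    by rewrite vy mem_image //= inE yr.
  rewrite -filter_predI; apply: eq_in_filter => v vl /=.
  have [y <-] := f_onto (L0_sub lL vl); rewrite !mem_image // inE negb_or.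
  by rewrite !inE (inj_eq f_inj) andbC.
have [xL|xL] := boolP (f x \in flatten (residual p)).
  have [j [W [ji WV sj]]] := safe_reply si xL.
  have [WV' Wa] := choicesP WV.
  exists (toT W :&: unplayed p'); split; first exact: subsetIr.
    by rewrite -Wa; apply: leq_trans (toT_card W); rewrite subset_leq_card ?subsetIl.
  move=> S /(step W _ WV') sub; apply: (InvI j); first exact: ltnW (leq_trans ji ik).
  exact: safe_sub sj.
(* Here [x] lies on no remaining line, so any reply will do and the fuel is kept. *)
exists set0; rewrite sub0set cards0; split=> // S _.
have sub : {subset residual (alice_move p' S) <=
    hit [::] (del (f x) (residual p))}.
  by apply: step => //; apply/subsetP => y; rewrite !inE.
apply: (InvI i) => //; apply: safe_sub si => l' /sub.
rewrite mem_filter => /andP[_ /mapP[l lr ->]].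
rewrite (_ : filter _ l = l) //; apply/all_filterP/allP => v vl /=.
by apply: contraNneq xL => <-; apply/flattenP; exists l.
Qed.
End LineGame.

(** * Cycles, and cliques of Cartesian products *)

Lemma val_iter_ordS n k (i : 'I_n) : iter k (@ordS n) i = (i + k) %% n :> nat.
Proof.
elim: k => [|k IH] /=; first by rewrite addn0 modn_small.
by rewrite IH -addn1 modnDml addn1 addnS.
Qed.

(** A shift by [k] has a fixed point only if [n] divides [k]. Most distinctness facts on cycles
    below reduce to this. *)
Lemma iter_ordS_neq n k (i : 'I_n) : 0 < k < n -> (iter k (@ordS n) i == i) = false.
Proof.
case/andP=> k0 kn; apply/eqP => /(congr1 val) /=; rewrite val_iter_ordS.
rewrite -{2}(modn_small (ltn_ord i)) -{2}[nat_of_ord i]addn0 => /eqP.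
by rewrite eqn_modDl mod0n modn_small // eqn0Ngt k0.
Qed.

Lemma cycle_graphE n (i j : 'I_n) :
  cycle_graph i j = (j == ordS i) || (j == ord_pred i).
Proof.
rewrite /cycle_graph; congr (_ || _).
by rewrite -(can2_eq (@ordSK n) (@ord_predK n)) eq_sym.
Qed.

(** Going around a triangle adds up three steps of 1 or -1, giving a total of ±1 or ±3, which is
    nonzero modulo [n]. *)
Lemma cycle_triangle n (i j k : 'I_n) : 3 < n ->
  cycle_graph i j -> cycle_graph i k -> cycle_graph j k -> False.
Proof.
move=> n3; have cE (x y : 'I_n) : cycle_graph x y = (y == ordS x) || (x == ordS y) by [].
have S1 (x : 'I_n) : ordS x <> x.
  by apply/eqP; rewrite (@iter_ordS_neq n 1) // (ltn_trans _ n3).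
have S3 (x : 'I_n) : ordS (ordS (ordS x)) <> x.
  by apply/eqP; rewrite (@iter_ordS_neq n 3).
move: (S1 i) (S1 j) (S1 k) (S3 i) (S3 j) (S3 k).
by rewrite !cE => ? ? ? ? ? ? /orP[]/eqP ? /orP[]/eqP ? /orP[]/eqP ?; congruence.
Qed.

Section CartesianCliques.
Variables (T U : finType) (g : rel T) (h : rel U).
Local Notation e := (cartesian_product g h).
Implicit Type K : {set T * U}.

Lemma clique_fiber2 K x y : (forall i i', i != i' -> g i i') ->
  clique e K -> x \in K -> y \in K -> x != y -> x.2 = y.2 ->
  K = [set z | z.2 == x.2].
Proof.
move=> gc cK xK yK xy xy2; apply/esym/(cliqueP cK) => [z z'|].
  rewrite !inE /cartesian_product => /eqP z2 /eqP z'2 zz'; rewrite z2 z'2 eqxx andbT.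
  by rewrite gc //; apply: contraNneq zz' => zz'1; rewrite -pair_eqE /= z2 z'2 zz'1 !eqxx.
apply/subsetP => z zK; rewrite inE; apply: contraT => zx2.
have z1 w : w \in K -> w.2 = x.2 -> z.1 = w.1.
  move=> wK w2; have zw : z != w by apply: contraNneq zx2 => ->; rewrite w2.
  have := clique_complete cK zK wK zw.
  by rewrite /cartesian_product w2 (negbTE zx2) andbF => /andP[/eqP].
case/negP: xy; rewrite -pair_eqE /pair_eq /= xy2 eqxx andbT.
by rewrite -(z1 x) // -(z1 y).
Qed.

Lemma clique_fiber1 K x y : (forall j j', j != j' -> h j j') ->
  clique e K -> x \in K -> y \in K -> x != y -> x.1 = y.1 ->
  K = [set z | z.1 == x.1].
Proof.
move=> hc cK xK yK xy xy1; apply/esym/(cliqueP cK) => [z z'|].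
  rewrite !inE /cartesian_product => /eqP z1 /eqP z'1 zz'; rewrite z1 z'1 eqxx /=.
  by rewrite hc ?orbT //; apply: contraNneq zz' => zz'2; rewrite -pair_eqE /= z1 z'1 zz'2 !eqxx.
apply/subsetP => z zK; rewrite inE; apply: contraT => zx1.
have z2 w : w \in K -> w.1 = x.1 -> z.2 = w.2.
  move=> wK w1; have zw : z != w by apply: contraNneq zx1 => ->; rewrite w1.
  have := clique_complete cK zK wK zw.
  by rewrite /cartesian_product w1 (negbTE zx1) orbF => /andP[_ /eqP].
case/negP: xy; rewrite -pair_eqE /pair_eq /= xy1 eqxx /=.
by rewrite -(z2 x) // -(z2 y).
Qed.

(** A vertex off the fiber is adjacent to at most one of its vertices; [i] and [i'] guarantee that
    it has two. *)
Lemma fiber2_clique (i i' : T) j : (forall i i', i != i' -> g i i') -> i != i' ->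
  clique e [set z | z.2 == j].
Proof.
move=> gc ii'; apply/maxsetP; split.
  apply/forall_inP => z; rewrite inE => /eqP z2.
  apply/forall_inP => z'; rewrite inE => /eqP z'2; apply/implyP => zz'.
  rewrite /cartesian_product z2 z'2 eqxx andbT gc //.
  by apply: contraNneq zz' => zz'1; rewrite -pair_eqE /= z2 z'2 zz'1 !eqxx.
move=> B /forall_inP cB /subsetP fB; apply/eqP; rewrite eqEsubset andbC.
apply/andP; split; first exact/subsetP.
apply/subsetP => z zB; rewrite inE; apply: contraT => zj.
have z1 k : z.1 = k.
  have kB : (k, j) \in B by apply: fB; rewrite inE.
  have /forall_inP /(_ _ kB) := cB _ zB.
  rewrite /cartesian_product /= (negbTE zj) andbF /=.
  have -> /= : z != (k, j) by apply: contraNneq zj => ->.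
  by case/andP => /eqP.
by rewrite -(z1 i) -(z1 i') eqxx in ii'.
Qed.

(** Two edges at a vertex that change different coordinates have other ends differing in both, hence
    not adjacent. *)
Lemma cartesian_triangle x y z : irreflexive g -> irreflexive h ->
  e x y -> e x z -> e y z ->
  [&& g x.1 y.1, g x.1 z.1 & g y.1 z.1] \/
  [&& h x.2 y.2, h x.2 z.2 & h y.2 z.2].
Proof.
move=> gi hi; rewrite /cartesian_product.
case: x y z => [x1 x2] [y1 y2] [z1 z2] /=.
case/orP=> /andP[] => [exy /eqP xy|/eqP xy exy];
case/orP=> /andP[] => [exz /eqP xz|/eqP xz exz];
case/orP=> /andP[] => [eyz /eqP yz|/eqP yz eyz]; subst;
move: (exy) (exz) (eyz); rewrite ?gi ?hi // ?exy ?exz ?eyz; auto.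
Qed.

End CartesianCliques.

(** The neighbor [y] shows that [x] is not isolated: if [K] were just [x], adding [y] would
    contradict maximality. *)
Lemma clique_neighbor (T : finType) (e : rel T) (K : {set T}) x y :
  symmetric e -> clique e K -> x \in K -> e x y -> exists2 z, e x z & z \in K.
Proof.
move=> es cK xK exy; have [z /andP[zx zK]|K1] := pickP [pred z | (z != x) && (z \in K)].
  by exists z => //; apply: clique_complete cK xK zK _; rewrite eq_sym.
exists y => //; suff <- : [set x; y] = K by rewrite set22.
apply: (cliqueP cK) => [u v /set2P[]-> /set2P[]->|]; rewrite ?eqxx // 1?es //.
by apply/subsetP => z zK; move: (K1 z); rewrite !inE zK andbT => /negbFE ->.
Qed.

(** This unifies the two starts for Bob's wins: [S] is Alice's opening, empty if Bob starts, and Bob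
    is to move. *)
Lemma winning_bob_turn (T : finType) (e : rel T) a alice_first :
  alice_has_winning_strategy e a 1 alice_first ->
  exists (S : {set T}) (R : bool -> position T -> Prop),
  [/\ #|S| <= (if alice_first then a else 0), R false (Position S set0),
   forall p x, R false p -> x \in unplayed p -> R true (bob_move p [set x]) &
   forall p (W : {set T}), R true p ->
     (forall y, y \in W -> y \in unplayed p /\
        exists2 K, clique e K & K \subset y |: blue p) ->
     exists S : {set T}, [/\ W \subset S, #|S| <= a & R false (alice_move p S)]].
Proof.
case/winning_positions=> R [R0 RA RB Rw].
have RF p W := @forced_reply _ e R a p W RA RB Rw.
case: alice_first R0 => [/RA[S /andP[_ /eqP cS]]|R0].
  by rewrite /alice_move set0U => RS; exists S, R; rewrite cS geq_minl.
by exists set0, R; rewrite cards0.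
Qed.

(** * Products of two cycles, and the bound 4 *)

Section Torus.
Variables n m : nat.
Hypotheses (n3 : 2 < n) (m3 : 2 < m).
Local Notation torus := (cartesian_product (@cycle_graph n) (@cycle_graph m)).
Implicit Types x y z : 'I_n * 'I_m.

Definition nbrs x : seq ('I_n * 'I_m) :=
  [:: (ordS x.1, x.2); (ord_pred x.1, x.2); (x.1, ordS x.2); (x.1, ord_pred x.2)].

Lemma torus_sym : symmetric torus.
Proof. by apply: cartesian_product_sym; apply: cycle_graph_sym. Qed.

Lemma torus_irr : irreflexive torus.
Proof. by apply: cartesian_product_irr; apply: cycle_graph_irr; apply: ltnW. Qed.

Lemma torusE x y : torus x y = (y \in nbrs x).
Proof.
case: x y => [i j] [i' j']; rewrite /cartesian_product !cycle_graphE /= !inE !xpair_eqE.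
by rewrite andb_orl andb_orr (eq_sym j) (eq_sym i) -!orbA.
Qed.

Lemma ordS_neq_pred k (i : 'I_k) : 2 < k -> (ordS i == ord_pred i) = false.
Proof.
move=> k3; rewrite -(inj_eq (@ordS_inj k)) ord_predK.
by rewrite (@iter_ordS_neq k 2).
Qed.

Lemma nbrs_uniq x : uniq (nbrs x).
Proof.
have S1 k (i : 'I_k) : 2 < k -> (ordS i == i) = false.
  by move=> k3; rewrite (@iter_ordS_neq k 1) //= ltnW.
have P1 k (i : 'I_k) : 2 < k -> (ord_pred i == i) = false.
  by move=> k3; rewrite -(inj_eq (@ordS_inj k)) ord_predK eq_sym S1.
by rewrite /= !inE !xpair_eqE !eqxx !ordS_neq_pred // !S1 // !P1.
Qed.

Lemma alice_wins4 alice_first : alice_has_winning_strategy torus 4 1 alice_first.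
Proof.
apply: (@cover_strategy _ _ (Ordinal (ltnW (ltnW n3)), Ordinal (ltnW (ltnW m3))) _ _
  (fun x => [set z in nbrs x])) => [x|x|x K cK xK].
- by rewrite inE -torusE torus_irr.
- by rewrite cardsE (leq_trans (card_size _)).
have [//||z xz zK] := @clique_neighbor _ torus K x (ordS x.1, x.2) torus_sym cK.
  by rewrite torusE mem_head.
by exists z; rewrite // inE -torusE.
Qed.

Lemma bob_wins4 a alice_first : 3 < n -> 3 < m -> a <= 3 ->
  ~ alice_has_winning_strategy torus a 1 alice_first.
Proof.
move=> n4 m4 a3 /winning_bob_turn[S [R [Sa RS RB RF]]].
have {Sa} S3 : #|S| <= 3.
  by apply: leq_trans Sa _; case: ifP.
have [x xS] : exists x, x \notin \bigcup_(s in S) [set z in s :: nbrs s].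
  apply/existsP; rewrite -negb_forall; apply: contraL S3 => /forallP all.
  have : #|[set: 'I_n * 'I_m]| <= #|\bigcup_(s in S) [set z in s :: nbrs s]|.
    by apply/subset_leq_card/subsetP => z _; apply: all.
  rewrite cardsT card_prod !card_ord -ltnNge => le.
  have /(leq_trans le) {le} : #|\bigcup_(s in S) [set z in s :: nbrs s]| <= \sum_(s in S) 5.
    apply: (big_ind2 (fun (A : {set _}) k => #|A| <= k)) => [|A k B l Ak Bl|s _].
    - by rewrite cards0.
    - by apply: leq_trans (leq_card_setU _ _) _; apply: leq_add.
    by rewrite cardsE (leq_trans (card_size _)).
  (* If [S] dominated all vertices, then 3 * 5 < 4 * 4 <= nm <= 5|S|, so [S] would have more than 3
     elements. *)
  rewrite sum_nat_const => le; rewrite -(@ltn_pmul2r 5) //.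
  by apply: leq_trans le; apply: (@leq_mul 4 4).
have xn s : s \in S -> x != s /\ ~~ torus s x.
  move=> sS; apply/andP; rewrite torusE -negb_or -in_cons.
  by apply: contra xS => xs; apply/bigcupP; exists s; rewrite ?in_set.
have xu : x \in unplayed (Position S set0).
  by rewrite !inE orbF; apply/negP => /xn[]; rewrite eqxx.
(* All four edges at [x] become threats at once. *)
have [y|S' [WS S'a _]] := RF _ [set z in nbrs x] (RB _ _ RS xu).
  rewrite inE -torusE => xy; split.
    rewrite !inE !negb_or /=; apply/andP; split.
      by apply/negP => /xn[_]; rewrite torus_sym xy.
    by apply: contraTneq xy => ->; rewrite torus_irr.
  exists [set x; y]; last by rewrite /= set0U setUC.
  apply: (clique_edge torus_sym) => // z xz yz.
  have := cartesian_triangle (cycle_graph_irr (ltnW n3)) (cycle_graph_irr (ltnW m3)).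
  case/(_ _ _ _ xy xz yz) => /and3P[p q r]; exact: cycle_triangle p q r.
have := leq_trans (subset_leq_card WS) (leq_trans S'a a3).
by rewrite cardsE (card_uniqP (nbrs_uniq x)).
Qed.
End Torus.

(** * Products of a triangle and a cycle *)

Lemma cycle3_complete (i i' : 'I_3) : i != i' -> cycle_graph i i'.
Proof. by case: i i' => [[|[|[|]]] ?] // [[|[|[|]]] ?]. Qed.

Lemma cycle3_other (c i : 'I_3) : i != c -> i != ordS c -> i = ordS (ordS c).
Proof.
by case: c i => [[|[|[|]]] ?] // [[|[|[|]]] ?] //= _ _; apply/val_inj.
Qed.

Section TriangularTorus.
Variable m : nat.
Hypothesis m3 : 2 < m.
Local Notation torus := (cartesian_product (@cycle_graph 3) (@cycle_graph m)).
Implicit Types x y z : 'I_3 * 'I_m.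

(** Some neighbor of [x] lies in [K]. If it is in the layer of [x], then [clique_fiber2] applies.
    The last two cases also cover the columns, which are triangles when [m] is 3. *)
Lemma triangle_or_edge (K : {set 'I_3 * 'I_m}) x : clique torus K -> x \in K ->
  [\/ K = [set z | z.2 == x.2], (x.1, ordS x.2) \in K | (x.1, ord_pred x.2) \in K].
Proof.
move=> cK xK.
have [//||z xz zK] := @clique_neighbor _ torus K x (ordS x.1, x.2) (@torus_sym 3 m) cK.
  by rewrite torusE mem_head.
have [z2|z2] := eqVneq z.2 x.2.
  constructor 1; apply: (clique_fiber2 cycle3_complete cK xK zK) => //.
  by apply: contraTneq xz => ->; rewrite torus_irr.
move: xz zK z2; rewrite torusE !inE => /or4P[]/eqP->; rewrite ?eqxx //.
  by constructor 2.
by constructor 3.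
Qed.

Lemma alice_wins3 alice_first : alice_has_winning_strategy torus 3 1 alice_first.
Proof.
(* One more vertex of the triangle of [x], and its neighbors in the two adjacent layers. *)
pose D x := [set z in [:: (ordS x.1, x.2); (x.1, ordS x.2); (x.1, ord_pred x.2)]].
apply: (@cover_strategy _ _ (ord0, Ordinal (ltnW (ltnW m3))) _ _ D) => [x|x|x K cK xK].
- rewrite inE; apply: contraFN (torus_irr (isT : 2 < 3) m3 x); rewrite torusE !inE.
  by case/or3P=> ->; rewrite ?orbT.
- by rewrite cardsE (leq_trans (card_size _)).
case: (triangle_or_edge cK xK) => [->|xzK|xzK].
- by exists (ordS x.1, x.2); rewrite !inE /= eqxx.
- by exists (x.1, ordS x.2); rewrite // !inE eqxx orbT.
by exists (x.1, ord_pred x.2); rewrite // !inE eqxx !orbT.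
Qed.

(** A triangle on this edge would have to lie in the factor [C_m], which has none for [m > 3]. *)
Lemma layer_edge i j z : 3 < m -> z = (i, ordS j) \/ z = (i, ord_pred j) ->
  clique torus [set (i, j); z].
Proof.
move=> m4 zE; have ijz : torus (i, j) z.
  by rewrite torusE !inE; case: zE => ->; rewrite eqxx !orbT.
apply: (clique_edge (@torus_sym 3 m) ijz) => w iw zw.
have := cartesian_triangle (@cycle_graph_irr 3 isT) (cycle_graph_irr (ltnW m3)).
case/(_ _ _ _ ijz iw zw) => /and3P[p q r]; last exact: cycle_triangle p q r.
by move: p; case: zE => -> /=; rewrite cycle_graph_irr.
Qed.

(* Bob plays twice in layer [j]: his first move forces Alice to use her two
   vertices in the adjacent layers, his second one makes three threats. *)
Lemma bob_wins_layer a (S : {set 'I_3 * 'I_m}) R x y j : 3 < m -> a <= 2 ->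
  R false (Position S set0) ->
  (forall p x, R false p -> x \in unplayed p -> R true (bob_move p [set x])) ->
  (forall p (W : {set 'I_3 * 'I_m}), R true p ->
     (forall y, y \in W -> y \in unplayed p /\
        exists2 K, clique torus K & K \subset y |: blue p) ->
     exists S : {set 'I_3 * 'I_m},
       [/\ W \subset S, #|S| <= a & R false (alice_move p S)]) ->
  S \subset [set x; y] -> x.2 \notin [:: j; ordS j; ord_pred j] -> y.2 != j ->
  False.
Proof.
move=> m4 a2 RS RB RF /subsetP Sxy xj yj.
have SP i k : (i, k) \in S -> k \in [:: j; ordS j; ord_pred j] -> i = y.1 /\ k != j.
  by move=> /Sxy/set2P[] E kj; move: xj yj; rewrite -E /= ?kj.
(* In layer [j] and the two adjacent ones only [y] can be red, so Bob plays the two columns other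
   than that of [y]. *)
pose c := y.1; pose i := ordS c; pose i' := ordS i.
have ic : (i == c) = false by exact: (@iter_ordS_neq 3 1 c).
have i'c : (i' == c) = false by exact: (@iter_ordS_neq 3 2 c).
have i'i : (i' == i) = false by exact: (@iter_ordS_neq 3 1 i).
have Sj : (ordS j == j) = false by rewrite (@iter_ordS_neq m 1) //= ltnW.
have Pj : (ord_pred j == j) = false.
  by rewrite -(inj_eq (@ordS_inj m)) ord_predK eq_sym Sj.
have SPj : (ordS j == ord_pred j) = false by apply: ordS_neq_pred.
have free k l : k != c -> l \in [:: j; ordS j; ord_pred j] -> ((k, l) \in S) = false.
  by move=> kc lj; apply/negP => /SP/(_ lj)[kc' _]; rewrite kc' eqxx in kc.
have freej k : ((k, j) \in S) = false.
  by apply/negP => /SP[]; rewrite ?mem_head // eqxx.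
have jmem : [/\ j \in [:: j; ordS j; ord_pred j], ordS j \in [:: j; ordS j; ord_pred j]
  & ord_pred j \in [:: j; ordS j; ord_pred j]] by rewrite !inE !eqxx !orbT.
case: jmem => j0 j1 j2.
have u1 : (i, j) \in unplayed (Position S set0) by rewrite !inE freej.
pose W1 := [set z in [:: (i, ordS j); (i, ord_pred j)]].
have [z|S1 [W1S S1a RS1]] := RF _ W1 (RB _ _ RS u1).
  rewrite inE => zW; have zE : z = (i, ordS j) \/ z = (i, ord_pred j).
    by move: zW; rewrite !inE => /orP[]/eqP->; [left | right].
  split; last first.
    by exists [set (i, j); z]; [apply: layer_edge | rewrite /= set0U setUC].
  by case: zE => ->; rewrite !inE !xpair_eqE free ?ic // eqxx /= ?Sj ?Pj.
(* Two forced vertices use up Alice's move, so her reply is exactly [W1]. *)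
have {S1a RS1 W1S} [S1E RS1] : S1 = W1 /\ R false (Position (S :|: W1) [set (i, j)]).
  suff E : W1 = S1 by rewrite E; split=> //; move: RS1; rewrite /alice_move /= set0U.
  apply/eqP; rewrite eqEcard W1S (leq_trans S1a) // (leq_trans a2) //.
  by rewrite cardsE; apply/eq_leq/esym/card_uniqP; rewrite /= inE xpair_eqE SPj eqxx.
have u2 : (i', j) \in unplayed (Position (S :|: W1) [set (i, j)]).
  by rewrite !inE freej !xpair_eqE i'i.
(* The third threat [(c, j)] would complete the triangle of layer [j]. *)
pose W2 := [set z in [:: (i', ordS j); (i', ord_pred j); (c, j)]].
have [z|S2 [W2S S2a _]] := RF _ W2 (RB _ _ RS1 u2).
  rewrite in_set !in_cons in_nil orbF => /or3P[]/eqP->; split.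
  - by rewrite !inE !xpair_eqE free ?i'c // i'i Sj !andbF.
  - exists [set (i', j); (i', ordS j)]; first by apply: layer_edge; auto.
    by rewrite subUset !sub1set !inE !eqxx !orbT.
  - by rewrite !inE !xpair_eqE free ?i'c // i'i Pj !andbF.
  - exists [set (i', j); (i', ord_pred j)]; first by apply: layer_edge; auto.
    by rewrite subUset !sub1set !inE !eqxx !orbT.
  - by rewrite !inE freej !xpair_eqE ![c == _]eq_sym ic i'c.
  exists [set z | z.2 == j].
    by apply: (@fiber2_clique _ _ _ _ i c); [exact: cycle3_complete | rewrite ic].
  apply/subsetP => -[k l]; rewrite !inE /= => /eqP->; rewrite !xpair_eqE eqxx !andbT.
  have [//|kc] := eqVneq k c; have [//|ki] := eqVneq k i.
  by rewrite (cycle3_other kc ki) eqxx.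
have := leq_trans (subset_leq_card W2S) (leq_trans S2a a2).
rewrite cardsE (card_uniqP _) //= !inE !xpair_eqE SPj i'c.
by rewrite !eqxx.
Qed.

Lemma bob_wins3 a alice_first : 3 < m -> a <= 2 ->
  [|| 4 < m, a <= 1 | ~~ alice_first] ->
  ~ alice_has_winning_strategy torus a 1 alice_first.
Proof.
move=> m4 a2 hyp /winning_bob_turn[S [R [Sa RS RB RF]]].
(* [x = y] encodes at most one red vertex; two are possible only if [m > 4]. *)
have [x [y [Sxy xy]]] : exists x y, S \subset [set x; y] /\ (4 < m \/ x = y).
  have z0 : 'I_3 * 'I_m := (ord0, Ordinal (ltnW (ltnW m3))).
  have [S1|] := leqP #|S| 1.
    have [->|/set0Pn[x xS]] := eqVneq S set0.
      by exists z0, z0; rewrite sub0set; auto.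
    exists x, x; split; last by right.
    have /eqP <- : [set x] == S by rewrite eqEcard sub1set xS cards1.
    exact: subsetUl.
  move=> S2; have {hyp} m5 : 4 < m.
    case/or3P: hyp => // [a1|/negbTE af]; last by move: Sa S2; rewrite af; case: #|S|.
    by move: (leq_trans S2 Sa); case: (alice_first) => // /leq_trans/(_ a1).
  have /cards2P[x [y [_ ->]]] : #|S| == 2.
    rewrite eqn_leq S2 andbT (leq_trans Sa) //; by case: ifP.
  by exists x, y; auto.
have m2 : 1 < m := ltnW m3.
have nS k i : 0 < k -> k < m -> (iter k (@ordS m) i == i) = false.
  by move=> k0 km; rewrite iter_ordS_neq ?k0.
have [j [xj yj]] : exists j, x.2 \notin [:: j; ordS j; ord_pred j] /\ y.2 != j.
  (* The layer two steps after that of [x] works unless it contains [y]. In that case the layer two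
     steps before works: the two candidates are four steps apart and differ as [m > 4]. *)
  pose p := x.2; pose q := ordS (ordS p).
  have [yq|yq] := eqVneq y.2 q; last first.
    exists q; split=> //; rewrite !inE /q ordSK -/p !(eq_sym p).
    by rewrite (nS 1) // (nS 2) // (nS 3).
  pose r := ord_pred (ord_pred p); have pE : p = ordS (ordS r) by rewrite /r !ord_predK.
  have m5 : 4 < m.
    by case: xy => // E; have := nS 2 p isT m3; rewrite /= -/q -yq -E eqxx.
  exists r; rewrite yq /q pE (nS 4) //; split=> //.
  rewrite !inE -/p pE (nS 2) // (inj_eq (@ordS_inj m)) (nS 1) //=.
  by rewrite -(inj_eq (@ordS_inj m)) ord_predK (nS 3).
exact: bob_wins_layer RS RB RF Sxy xj yj.
Qed.
End TriangularTorus.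

(** * The searches on C_3 x C_3 and C_3 x C_4 *)

Section GridSearch.
Variable m : nat.
Hypothesis m3 : 2 < m.
Local Notation torus := (cartesian_product (@cycle_graph 3) (@cycle_graph m)).

(** Natural numbers replace ordinals so that the search can be evaluated. *)
Definition grid : seq (nat * nat) := [seq (i, j) | i <- iota 0 3, j <- iota 0 m].
Definition layers := [seq [seq (i, j) | i <- iota 0 3] | j <- iota 0 m].
Definition columns := [seq [seq (i, j) | j <- iota 0 m] | i <- iota 0 3].
Definition column_edges :=
  [seq [:: (i, j); (i, j.+1 %% m)] | i <- iota 0 3, j <- iota 0 m].

Definition coords (z : 'I_3 * 'I_m) : nat * nat := (val z.1, val z.2).

Lemma coords_inj : injective coords.
Proof. by move=> [i j] [i' j'] [/val_inj-> /val_inj->]. Qed.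

Lemma mem_grid i j : ((i, j) \in grid) = (i < 3) && (j < m).
Proof.
apply/allpairsP/andP => [[[i' j'] [+ + [-> ->]]]|[i3 jm]].
  by rewrite !mem_iota => /andP[_ ?] /andP[_ ?].
by exists (i, j); rewrite !mem_iota.
Qed.

Lemma coords_onto v : v \in grid -> exists z, coords z = v.
Proof.
by case: v => i j; rewrite mem_grid => /andP[i3 jm]; exists (Ordinal i3, Ordinal jm).
Qed.

Lemma layers_sub l : l \in layers -> {subset l <= grid}.
Proof.
case/mapP=> j + -> _ /mapP[i + ->].
by rewrite mem_grid !mem_iota => /andP[_ ->] /andP[_ ->].
Qed.

Lemma columns_sub l : l \in columns -> {subset l <= grid}.
Proof.
case/mapP=> i + -> _ /mapP[j + ->].
by rewrite mem_grid !mem_iota => /andP[_ ->] /andP[_ ->].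
Qed.

Lemma column_edges_sub l : l \in column_edges -> {subset l <= grid}.
Proof.
case/allpairsP=> -[i j] [+ + -> v]; rewrite !mem_iota !inE => /andP[_ i3] /andP[_ jm].
have m0 : 0 < m by apply: leq_trans m3.
by case/orP=> /eqP->; rewrite mem_grid i3 ?ltn_mod.
Qed.

Lemma layer_line (j : 'I_m) : exists2 l, l \in layers &
  forall z, coords z \in l -> z \in [set z : 'I_3 * 'I_m | z.2 == j].
Proof.
exists [seq (i, val j) | i <- iota 0 3]; first by apply: map_f; rewrite mem_iota /=.
by move=> z /mapP[i _ [_ zj]]; rewrite inE; apply/eqP/val_inj.
Qed.

Lemma edge_line (i : 'I_3) (j : 'I_m) (K : {set 'I_3 * 'I_m}) :
  (i, j) \in K -> (i, ordS j) \in K ->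
  exists2 l, l \in column_edges & forall z, coords z \in l -> z \in K.
Proof.
move=> K1 K2; exists [:: coords (i, j); coords (i, ordS j)].
  by apply/allpairsP; exists (val i, val j); rewrite !mem_iota /=.
by move=> z; rewrite !inE !(inj_eq coords_inj) => /orP[]/eqP->.
Qed.

Lemma edge_lines_clique (K : {set 'I_3 * 'I_m}) : clique torus K ->
  exists2 l, l \in layers ++ column_edges & forall z, coords z \in l -> z \in K.
Proof.
move=> cK; have z0 : 'I_3 * 'I_m := (ord0, Ordinal (ltnW (ltnW m3))).
have [x xK] := set0Pn _ (clique_nonempty z0 cK).
suff: (exists2 l, l \in layers & forall z, coords z \in l -> z \in K) \/
      (exists2 l, l \in column_edges & forall z, coords z \in l -> z \in K).
  by case=> -[l lL lK]; exists l; rewrite // mem_cat lL ?orbT.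
have xE : (x.1, x.2) \in K by case: (x) xK.
case: (triangle_or_edge m3 cK xK) => [->|SK|PK].
- by left; apply: layer_line.
- by right; apply: edge_line SK.
(* The edge to the previous layer is listed from its other end. *)
by right; apply: (edge_line PK); rewrite ord_predK.
Qed.

(** For [m = 3] the second factor is complete too, so two vertices in one column force the whole
    column by [clique_fiber1]. *)
Lemma column_lines_clique (K : {set 'I_3 * 'I_m}) : m = 3 -> clique torus K ->
  exists2 l, l \in layers ++ columns & forall z, coords z \in l -> z \in K.
Proof.
move=> mE cK; have z0 : 'I_3 * 'I_m := (ord0, Ordinal (ltnW (ltnW m3))).
have [x xK] := set0Pn _ (clique_nonempty z0 cK).
have column y : y \in K -> x != y -> x.1 = y.1 ->
    exists2 l, l \in columns & forall z, coords z \in l -> z \in K.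
  move=> yK xy xy1; have hc : forall j j' : 'I_m, j != j' -> cycle_graph j j'.
    by rewrite mE; apply: cycle3_complete.
  rewrite (clique_fiber1 hc cK xK yK xy xy1).
  exists [seq (val x.1, j) | j <- iota 0 m].
    by apply: (map_f (fun i => [seq (i, j) | j <- iota 0 m])); rewrite mem_iota /=.
  by move=> z /mapP[j _ [zi _]]; rewrite inE; apply/eqP/val_inj.
suff: (exists2 l, l \in layers & forall z, coords z \in l -> z \in K) \/
      (exists2 l, l \in columns & forall z, coords z \in l -> z \in K).
  by case=> -[l lL lK]; exists l; rewrite // mem_cat lL ?orbT.
have irr z : torus x z -> x != z by apply: contraTneq => <-; rewrite torus_irr.
case: (triangle_or_edge m3 cK xK) => [->|SK|PK].
- by left; apply: layer_line.
- by right; apply: column SK _ _ => //; apply: irr; rewrite torusE !inE eqxx !orbT.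
by right; apply: column PK _ _ => //; apply: irr; rewrite torusE !inE eqxx !orbT.
Qed.
End GridSearch.

(** The search starts from the empty board with Bob to move. This also settles the Alice-start game,
    since an opening can only help her. *)
Lemma alice_wins33 alice_first : alice_has_winning_strategy
  (cartesian_product (@cycle_graph 3) (@cycle_graph 3)) 1 1 alice_first.
Proof.
(* The closing [//] evaluates [safe], that is, runs the search. *)
apply: (@line_game_strategy _ (grid 3) 1 _ _ (@coords 3)
  (layers 3 ++ columns 3) _ _ _ _ alice_first 4 [::]) => //.
- exact: coords_inj.
- exact: coords_onto.
- by move=> l; rewrite mem_cat => /orP[/layers_sub|/columns_sub].
- by move=> K; apply: column_lines_clique.
- by rewrite orbT.
Qed.

Lemma alice_wins34 : alice_has_winning_strategy
  (cartesian_product (@cycle_graph 3) (@cycle_graph 4)) 2 1 true.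
Proof.
apply: (@line_game_strategy _ (grid 4) 2 _ _ (@coords 4)
  (* The opening makes layers 0 and 2 contain a red vertex, and leaves layers 1 and 3 with only
     column 2 free of red in the adjacent layers. *)
  (layers 4 ++ column_edges 4) _ _ _ _ true 3 [:: (0, 0); (1, 2)]) => //.
- exact: coords_inj.
- exact: coords_onto.
- by move=> l; rewrite mem_cat => /orP[/layers_sub|/column_edges_sub]; apply.
- exact: edge_lines_clique.
- by move=> v; rewrite !inE => /orP[]/eqP->.
Qed.

(** * The thresholds *)

Theorem theorem4p1 (n m : nat) (hn : 3 <= n) (hnm : n <= m) :
  is_a1 (cartesian_product (@cycle_graph n) (@cycle_graph m))
    (if (n == 3) && (m == 3) then 1
     else if (n == 3) && (m == 4) then 2
     else if (n == 3) && (5 <= m) then 3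
     else 4)
  /\
  is_a1' (cartesian_product (@cycle_graph n) (@cycle_graph m))
    (if (n == 3) && (m == 3) then 1
     else if (n == 3) && (4 <= m) then 3
     else 4).
Proof.
have hm := leq_trans hn hnm.
have [n3|n4] := altP (n =P 3); last first.
  have {}n4 : 3 < n by rewrite ltn_neqAle eq_sym n4.
  have b4 a b : alice_has_winning_strategy
      (cartesian_product (@cycle_graph n) (@cycle_graph m)) a 1 b -> 3 < a.
    move=> w; rewrite ltnNge; apply/negP => a3.
    exact: (bob_wins4 hn hm n4 (leq_trans n4 hnm) a3 w).
  by split; split=> //; [apply: alice_wins4|move=> a _ /b4|
    apply: alice_wins4|move=> a _ /b4].
subst n; rewrite /=.
(* [k] is a number with which Alice loses: 2 if Bob starts or [m > 4], and 1 if Alice starts and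
   [m = 4]. *)
have b3 a b k : 3 < m -> k <= 2 -> [|| 4 < m, k <= 1 | ~~ b] ->
    alice_has_winning_strategy
      (cartesian_product (@cycle_graph 3) (@cycle_graph m)) a 1 b -> k < a.
  move=> m4 k2 c w; rewrite ltnNge; apply/negP => ak.
  apply: (bob_wins3 hm m4 (leq_trans ak k2) _ w).
  by case/or3P: c => [->|/(leq_trans ak)->|->]; rewrite ?orbT.
have [m3|m3] := altP (m =P 3).
  by subst m; split; split=> //; apply: alice_wins33.
have m4 : 3 < m by rewrite ltn_neqAle eq_sym m3.
rewrite m4; split; last first.
  split=> //; first exact: alice_wins3.
  by move=> a _; apply: b3; rewrite ?orbT.
have [mE|m5] := altP (m =P 4).
  subst m; split=> //; first exact: alice_wins34.
  by move=> a _; apply: b3; rewrite ?orbT.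
have {}m5 : 4 < m by rewrite ltn_neqAle eq_sym m5.
rewrite m5; split=> //; first exact: alice_wins3.
by move=> a _; apply: b3; rewrite ?m5.
Qed.
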